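(* Consider the two-agent problem described in the context. Then agent $i$, $i=1,2$, can, without loss of optimality, restrict itself to strategies of the form $$M^i_t=\bar f^i_t(X^i_t,C_t),\qquad U^i_t=\bar g^i_t(X^i_t,C_{t^+}),\qquad t=1,\dots,T,$$ where $C_t=(Z_{1:t-1},M^{1,2}_{1:t-1})$ and $C_{t^+}=(Z_{1:t},M^{1,2}_{1:t})$. That is, the minimum of the expected total cost $$\mathbb{E}\Big[\sum_{t=1}^{T}\big(c_t(X_t,U_t)+\rho\,\mathbf 1_{\{M^{or}_t=1\}}\big)\Big]$$ over all communication and control strategies of the two agents is attained by strategies in which both agents $i=1,2$ use communication laws of the form $M^i_t=\bar f^i_t(X^i_t,C_t)$ and control laws of the form $U^i_t=\bar g^i_t(X^i_t,C_{t^+})$, $t=1,\dots,T$; in other words, at time $t$, agent $i$ does not need the past local states and actions $X^i_{1:t-1},U^i_{1:t-1}$ for making optimal decisions.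
   Context: Two agents $i=1,2$ operate over times $t=1,\dots,T$. The local state of agent $i$ is $X^i_t\in\mathcal X^i$, its control action is $U^i_t\in\mathcal U^i$ ($\mathcal X^i,\mathcal U^i$ finite); $X_t=(X^1_t,X^2_t)$, $U_t=(U^1_t,U^2_t)$. Dynamics: $X^i_{t+1}=k^i_t(X^i_t,U^i_t,W^i_t)$ with given functions $k^i_t$, where $W^i_t\in\mathcal W^i$ has distribution $P_{W^i}$ and $X^i_1$ has distribution $P_{X^i_1}$. The random variables $X^1_1,X^2_1$ and $W^i_t$ ($i=1,2$, $t\ge1$) are mutually independent. At each $t$, agent $i$ first chooses a communication decision $M^i_t\in\{0,1\}$. Let $M^{or}_t=\max(M^1_t,M^2_t)$. The information exchanged is $Z_t=(X^1_t,X^2_t)$ if $M^{or}_t=1$, and $Z_t=\phi$ (a blank symbol) if $M^{or}_t=0$. Then agent $i$ chooses $U^i_t$. Here $M^{1,2}_t=(M^1_t,M^2_t)$ and $Y_{1:t}=(Y_1,\dots,Y_t)$. Before communication at time $t$, agent $i$ has information $I^i_t=\{X^i_{1:t},U^i_{1:t-1},Z_{1:t-1},M^{1,2}_{1:t-1}\}$ and a general communication strategy has the form $M^i_t=f^i_t(I^i_t)$. After communication it has $I^i_{t^+}=\{I^i_t,Z_t,M^{1,2}_t\}$ and a general control strategy has the form $U^i_t=g^i_t(I^i_{t^+})$. The functions $f^i_t,g^i_t$ are arbitrary. The instantaneous costs $c_t(X_t,U_t)$ are given real-valued functions, and $\rho$ is a given communication cost incurred each time $M^{or}_t=1$. The agents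 jointly choose $(f^i_t,g^i_t)_{i,t}$ to minimize the expected total cost. *)

(* Defs.v *)
From HB Require Import structures.
From mathcomp Require Import all_boot all_order all_algebra finmap.
From mathcomp Require Import all_classical all_reals all_analysis.

Set Implicit Arguments.
Unset Strict Implicit.
Unset Printing Implicit Defensive.

Import GRing.Theory Num.Theory.
Local Open Scope classical_set_scope.
Local Open Scope ring_scope.

(* The two agents are ord0 and ord_max in 'I_2.  Times are shifted by one:
   index t : nat stands for time t + 1, so t is also the number of completed
   past steps, and the horizon 1, ..., T corresponds to t < T. *)

Section Information.
Variables X U : 'I_2 -> finType.

Definition joint (A : 'I_2 -> finType) := {dffun forall i, A i}.

(* None is the blank symbol. *)
Definition message := option (joint X).

Definition comm_decisions := {ffun 'I_2 -> bool}.

Definition Mor (m : comm_decisions) : bool := m ord0 || m ord_max.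

(* (Z_{1:n}, M^{1,2}_{1:n}).  At index t, the common information before
   communication has n = t, and after communication n = t.+1. *)
Definition common (n : nat) := (n.-tuple message * n.-tuple comm_decisions)%type.

(* I^i_t = (X^i up to and including the current state, past U^i, C_t). *)
Definition info_before (i : 'I_2) (t : nat) :=
  (t.+1.-tuple (X i) * t.-tuple (U i) * common t)%type.

(* I^i_{t+}, with Z_t and M^{1,2}_t appended to the common part. *)
Definition info_after (i : 'I_2) (t : nat) :=
  (t.+1.-tuple (X i) * t.-tuple (U i) * common t.+1)%type.

Record strategy := Strategy {
  comm_law : forall i t, info_before i t -> bool;
  ctrl_law : forall i t, info_after i t -> U i }.

Record reduced_strategy := ReducedStrategy {
  reduced_comm : forall i (t : nat), X i -> common t -> bool;
  reduced_ctrl : forall i (t : nat), X i -> common t.+1 -> U i }.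

Definition strategy_of_reduced (s : reduced_strategy) : strategy :=
  @Strategy
    (fun i t I => reduced_comm s (tnth I.1.1 ord_max) I.2)
    (fun i t I => reduced_ctrl s (tnth I.1.1 ord_max) I.2).

(* All variables realized when the agents are about to communicate at index t. *)
Record history (t : nat) := History {
  hist_X : forall i, t.+1.-tuple (X i);
  hist_U : forall i, t.-tuple (U i);
  hist_C : common t }.

End Information.

Section ClosedLoop.
Variables X U : 'I_2 -> finType.
Variable s : strategy X U.

Section Step.
Variables (t : nat) (h : history X U t).

Definition cur_state : joint X := [ffun i => tnth (hist_X h i) ord_max].

Definition cur_comm : comm_decisions :=
  [ffun i => comm_law s (hist_X h i, hist_U h i, hist_C h)].

Definition cur_message : message X :=
  if Mor cur_comm then Some cur_state else None.

Definition common_after : common X t.+1 :=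
  (rcons_tuple (hist_C h).1 cur_message, rcons_tuple (hist_C h).2 cur_comm).

Definition cur_action : joint U :=
  [ffun i => ctrl_law s (hist_X h i, hist_U h i, common_after)].

End Step.

Variable W : 'I_2 -> Type.
Variable k : forall i, nat -> X i -> U i -> W i -> X i.

Definition next_history (w : forall i, W i) t (h : history X U t) :
    history X U t.+1 :=
  History
    (fun i => rcons_tuple (hist_X h i)
                (k t (cur_state h i) (cur_action h i) (w i)))
    (fun i => rcons_tuple (hist_U h i) (cur_action h i))
    (common_after h).

Fixpoint run (x1 : forall i, X i) (w : forall i, nat -> W i) (t : nat) :
    history X U t :=
  match t with
  | 0 => History (fun i => [tuple x1 i]) (fun i => [tuple]) ([tuple], [tuple])
  | t'.+1 => next_history (fun i => w i t') (run x1 w t')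
  end.

Variables (R : realType) (c : nat -> joint X -> joint U -> R) (rho : R).

Definition stage_cost t (h : history X U t) : R :=
  c t (cur_state h) (cur_action h) + rho * (Mor (cur_comm h))%:R.

Definition total_cost (T : nat) (x1 : forall i, X i)
    (w : forall i, nat -> W i) : R :=
  \sum_(t < T) stage_cost (run x1 w t).

End ClosedLoop.

Definition expected_cost (X U : 'I_2 -> finType) (W : 'I_2 -> Type)
    (k : forall i, nat -> X i -> U i -> W i -> X i) (R : realType)
    (c : nat -> joint X -> joint U -> R) (rho : R) (T : nat)
    (d : measure_display) (Omega : measurableType d) (P : probability Omega R)
    (x1 : forall i, Omega -> X i) (w : forall i, nat -> Omega -> W i)
    (s : strategy X U) : \bar R :=
  'E_P[fun omega => total_cost s k c rho T (x1^~ omega)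
                      (fun i t => w i t omega)].

Definition mutually_independent (R : realType) (d : measure_display)
    (Omega : measurableType d) (P : probability Omega R)
    (I : choiceType) (F : I -> set_system Omega) : Prop :=
  forall (J : {fset I}) (A : I -> set Omega),
    (forall j, j \in J -> F j (A j)) ->
    P (\bigcap_(j in [set` J]) A j) = (\prod_(j <- J) P (A j))%E.

(* Family of the sigma-algebras generated by the primitive random variables:
   (i, None) is that of the initial state of agent i (all subsets of the finite
   set X i being measurable), (i, Some t) that of its noise at index t. *)
Definition primitive_events (X : 'I_2 -> finType) (dW : 'I_2 -> measure_display)
    (W : forall i, measurableType (dW i)) (Omega : Type)
    (x1 : forall i, Omega -> X i) (w : forall i, nat -> Omega -> W i)
    (j : 'I_2 * option nat) : set_system Omega :=
  match j.2 with
  | None => preimage_set_system setT (x1 j.1) setT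
  | Some t => preimage_set_system setT (w j.1 t) measurable
  end.

(* Main.v *)
Require Import Defs.
From mathcomp Require Import all_boot all_order all_algebra finmap.
From mathcomp Require Import all_classical all_reals all_analysis.

Set Implicit Arguments.
Unset Strict Implicit.
Unset Printing Implicit Defensive.

Import Order.TTheory GRing.Theory Num.Theory.
Local Open Scope classical_set_scope.
Local Open Scope ring_scope.

(** Why past local states and actions are useless.

    Only the finite-valued map (x, u) |-> k i t x u w ever matters of a noise
    value w.  Replacing each noise variable by that map ([responses]) turns the
    expected cost into a finite sum over noise tuples n, weighted by a product
    over independent coordinates ([expected_cost_mean_cost]).

    In the finite model the key fact is a cut-and-paste property of
    deterministic protocols, [closed_loop_rectangle]: if two noise tuples n and
    n' produce the same common information at index t, then so does the tuple
    that takes the past noise of agent i from n and everything else from n', and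
    under it agent i has the private history of n while the other agent has that
    of n'.  This is the conditional independence of the private histories given
    the common information, stated without any probability.  Because weights are
    products, swapping the past noise of agent i between n and n' preserves the
    joint weight of the pair ([sum_splice]).

    Suppose that agent i already uses reduced laws after index t.  Fix the
    current state x and the common information z, and let n and n' both lead to
    (x, z).  If agent i acts at index t, under n', as if its private history were
    the one of n, the remaining cost is the one of the spliced tuple
    ([mimic_tail]): the past of agent i no longer influences anything else.
    Averaging over both n and n', the swap shows that mimicking a random n costs
    exactly as much as the original strategy, so mimicking some fixed n is at
    least as good ([best_representative]).  Choosing this representative for each
    (x, z) makes the laws of agent i at index t functions of (x, z) and leaves all
    other laws alone ([exchange]).  Backward induction on t, for both agents,
    yields a reduced strategy that is at least as good ([reduce_all]).

    Finally, a strategy enters the finite sum only through the finitely many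
    trajectories it can generate, so a best strategy exists ([mean_cost_min]),
    and reducing it gives the claim. *)

(** * Information and laws of one stage *)

Section Laws.
Variables X U : 'I_2 -> finType.
Implicit Types (s : strategy X U) (i j : 'I_2) (t : nat).

Definition private_info j t := (t.+1.-tuple (X j) * t.-tuple (U j))%type.

Definition private_of t (h : history X U t) j : private_info j t := (hist_X h j, hist_U h j).

Definition local_state t (h : history X U t) j : X j := tnth (hist_X h j) ord_max.

Definition tuple_past (A : Type) n (a : n.+1.-tuple A) : n.-tuple A :=
  belast_tuple (thead a) (behead_tuple a).

Definition common_past t (z : common X t.+1) : common X t :=
  (tuple_past z.1, tuple_past z.2).

Lemma tuple_past_rcons A n (a : n.-tuple A) x : tuple_past (rcons_tuple a x) = a.
Proof. by apply: val_inj; case: n a => [|n] [[|y a] //= sz]; rewrite belast_rcons. Qed.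

Lemma tnth_rcons_max A n (a : n.-tuple A) x : tnth (rcons_tuple a x) ord_max = x.
Proof. by rewrite (tnth_nth x) /= nth_rcons size_tuple ltnn eqxx. Qed.

Lemma common_past_after s t (h : history X U t) :
  common_past (common_after s h) = hist_C h.
Proof. by rewrite /common_past /= !tuple_past_rcons; case: (hist_C h). Qed.

Lemma common_after_inj s s' t (h h' : history X U t) :
    common_after s h = common_after s' h' ->
  [/\ hist_C h = hist_C h', cur_message s h = cur_message s' h'
    & cur_comm s h = cur_comm s' h'].
Proof.
move=> e; split.
- by rewrite -(common_past_after s) e common_past_after.
- by have := congr1 (fun z => tnth z.1 ord_max) e; rewrite /= !tnth_rcons_max.
- by have := congr1 (fun z => tnth z.2 ord_max) e; rewrite /= !tnth_rcons_max.
Qed.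

Lemma cur_commE s t (h : history X U t) j :
  cur_comm s h j = comm_law s (private_of h j, hist_C h).
Proof. by rewrite ffunE. Qed.

Lemma cur_actionE s t (h : history X U t) j :
  cur_action s h j = ctrl_law s (private_of h j, common_after s h).
Proof. by rewrite ffunE. Qed.

Lemma cur_stateE t (h : history X U t) j : cur_state h j = local_state h j.
Proof. by rewrite ffunE. Qed.

Definition same_moves s s' t (h : history X U t) :=
  cur_comm s h = cur_comm s' h /\ cur_action s h = cur_action s' h.

Lemma same_movesI s s' t (h : history X U t) :
    (forall j, comm_law s (private_of h j, hist_C h)
             = comm_law s' (private_of h j, hist_C h)) ->
    (forall j z, common_past z = hist_C h ->
       ctrl_law s (private_of h j, z) = ctrl_law s' (private_of h j, z)) ->
  same_moves s s' h.
Proof.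
move=> ef eg; have ec : cur_comm s h = cur_comm s' h.
  by apply/ffunP => j; rewrite !cur_commE.
split=> //; apply/ffunP => j; rewrite !cur_actionE.
have -> : common_after s h = common_after s' h by rewrite /common_after /cur_message ec.
exact/eg/common_past_after.
Qed.

(** Equality of the last entries of the two state tuples means equality of the
    current local states, so such laws can see only X^i_t and the common
    information. *)
Definition reduced_at s j t :=
  (forall (a b : private_info j t) z, tnth a.1 ord_max = tnth b.1 ord_max ->
     comm_law s (a, z) = comm_law s (b, z)) /\
  (forall (a b : private_info j t) z, tnth a.1 ord_max = tnth b.1 ord_max ->
     ctrl_law s (a, z) = ctrl_law s (b, z)).

End Laws.

(** * Closed loop driven by finitely many noise coordinates *)

Section FiniteModel.
Variables X U N : 'I_2 -> finType.
Variable k : forall i, nat -> X i -> U i -> N i -> X i.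
Variable T : nat.
Implicit Types (s : strategy X U) (i j : 'I_2) (t : nat).

(** Slot (i, None) holds the initial state of agent i and (i, Some t) its noise
    at index t.  Indices up to T inclusive are kept, one more than needed, so
    that [inord] turns any index into a slot. *)
Definition slot := ('I_2 * option 'I_T.+1)%type.

Definition slot_type (q : slot) : finType := if q.2 is Some _ then N q.1 else X q.1.

Definition noise := {dffun forall q : slot, slot_type q}.

Definition start (n : noise) j : X j := n (j, None).
Definition driver (n : noise) j t : N j := n (j, Some (inord t)).
Definition closed_loop s (n : noise) t := run s k (start n) (driver n) t.

(** Two strategies need to agree only on the histories that one of them actually
    visits. *)
Lemma closed_loop_ext s s' n t :
    (forall t', (t' < t)%N -> same_moves s s' (closed_loop s n t')) ->
  closed_loop s n t = closed_loop s' n t.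
Proof.
elim: t => //= t IH same; rewrite /closed_loop /= -!/(closed_loop _ _ _).
rewrite -IH => [|t' lt]; last exact/same/ltnW.
have [ec ea] := same t (ltnSn t).
by rewrite /next_history /common_after /cur_message ec ea.
Qed.

(** Rectangle property of deterministic protocols.  Once the common information
    z is given, the private history of agent j is computed from its own noise
    alone, and whether the run is consistent with z is decided agent by agent.
    Hence agents whose noises come from different runs, all consistent with z,
    can be put together.  Exchanged states need care: a message reveals both
    states, but equality of the messages forces these states to be the same in
    all the source runs. *)
Lemma closed_loop_rectangle s (src : 'I_2 -> noise) (m : noise) t (z : common X t) :
    (forall j, start m j = start (src j) j) ->
    (forall j t', (t' < t)%N -> driver m j t' = driver (src j) j t') ->
    (forall j, hist_C (closed_loop s (src j) t) = z) ->
  hist_C (closed_loop s m t) = z /\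
  forall j, private_of (closed_loop s m t) j = private_of (closed_loop s (src j) t) j.
Proof.
move=> m0 mw; elim: t z mw => [|t IH] z mw eqz.
  by split=> [|j]; [rewrite -(eqz ord0) | rewrite /private_of /= m0].
have eqC j : common_after s (closed_loop s (src j) t) = z by exact: eqz.
have [||eH ep] := IH (common_past z).
- by move=> j t' lt; apply: mw; apply: ltnW.
- by move=> j; rewrite -(eqC j) common_past_after.
have eh j : hist_C (closed_loop s (src j) t) = hist_C (closed_loop s m t).
  by rewrite eH -(eqC j) common_past_after.
have ecomm j : cur_comm s (closed_loop s m t) = cur_comm s (closed_loop s (src j) t).
  apply/ffunP => j'; rewrite cur_commE ep -(eh j') -cur_commE.
  by have [_ _ ->] := common_after_inj (etrans (eqC j') (esym (eqC j))).
have emsg j : cur_message s (closed_loop s m t) = cur_message s (closed_loop s (src j) t).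
  (* If a message is sent, it shows the same joint state in every source run. *)
  have eq_msg j' : cur_message s (closed_loop s (src j') t)
                 = cur_message s (closed_loop s (src j) t).
    by have [_ -> _] := common_after_inj (etrans (eqC j') (esym (eqC j))).
  move: eq_msg; rewrite /cur_message (ecomm j).
  case: ifP => // mor eq_msg; congr Some; apply/ffunP => j'.
  have := eq_msg j'; rewrite -(ecomm j') (ecomm j) mor => -[] <-.
  by rewrite !cur_stateE; have := ep j'; rewrite /private_of /local_state => -[-> _].
have eC : common_after s (closed_loop s m t) = z.
  by rewrite -(eqC ord0) /common_after -(emsg ord0) -(ecomm ord0) (eh ord0).
split=> // j; have := ep j; rewrite /private_of /= => -[eX eU].
by rewrite !cur_actionE !cur_stateE eC eqC ep /local_state eX eU mw.
Qed.

(** If agent i uses reduced laws from index t on, then all later costs are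
    determined by its current state, the common information, the private
    histories of the others and the future noise. *)
Lemma closed_loop_forget s i t (n n' : noise) :
    (forall j t', (t <= t' < T)%N -> driver n j t' = driver n' j t') ->
    (forall t', (t <= t' < T)%N -> reduced_at s i t') ->
    hist_C (closed_loop s n t) = hist_C (closed_loop s n' t) ->
    local_state (closed_loop s n t) i = local_state (closed_loop s n' t) i ->
    (forall j, j != i ->
       private_of (closed_loop s n t) j = private_of (closed_loop s n' t) j) ->
  forall t', (t <= t' < T)%N ->
  forall (R : realType) (c : nat -> joint X -> joint U -> R) rho,
  stage_cost s c rho (closed_loop s n t') = stage_cost s c rho (closed_loop s n' t').
Proof.
move=> eqw red eqC eqx eqp.
pose sim t' := [/\ hist_C (closed_loop s n t') = hist_C (closed_loop s n' t'),
    local_state (closed_loop s n t') i = local_state (closed_loop s n' t') i &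
    forall j, j != i ->
      private_of (closed_loop s n t') j = private_of (closed_loop s n' t') j].
have moves t' : (t <= t' < T)%N -> sim t' ->
  [/\ cur_comm s (closed_loop s n t') = cur_comm s (closed_loop s n' t'),
      cur_state (closed_loop s n t') = cur_state (closed_loop s n' t'),
      common_after s (closed_loop s n t') = common_after s (closed_loop s n' t') &
      cur_action s (closed_loop s n t') = cur_action s (closed_loop s n' t')].
  move=> lt [eC ex ep]; have [redf redg] := red t' lt.
  have ec : cur_comm s (closed_loop s n t') = cur_comm s (closed_loop s n' t').
    apply/ffunP => j; rewrite !cur_commE eC.
    have [->|ji] := eqVneq j i; first exact: redf.
    by rewrite ep.
  have es : cur_state (closed_loop s n t') = cur_state (closed_loop s n' t').
    apply/ffunP => j; rewrite !cur_stateE.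
    have [->|/ep] := eqVneq j i; first exact: ex.
    by rewrite /private_of /local_state => -[-> _].
  have ea : common_after s (closed_loop s n t') = common_after s (closed_loop s n' t').
    by rewrite /common_after /cur_message eC ec es.
  split=> //; apply/ffunP => j; rewrite !cur_actionE ea.
  have [->|ji] := eqVneq j i; first exact: redg.
  by rewrite ep.
have simP t' : (t <= t' < T)%N -> sim t'.
  elim: t' => [|t' IH].
    by rewrite leqn0 => /andP[/eqP t0 _]; move: eqC eqx eqp; rewrite t0.
  rewrite leq_eqVlt => /andP[/orP[/eqP <- _|]]; first by split.
  rewrite ltnS => lt /ltnW ltT.
  have ltt : (t <= t' < T)%N by rewrite lt.
  have [ec es eca ea] := moves _ ltt (IH ltt); have [eC ex ep] := IH ltt.
  split=> [||j ji]; first exact: eca.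
    rewrite /local_state /= !tnth_rcons_max -/(closed_loop _ _ _) -/(closed_loop _ _ _).
    by rewrite es ea eqw.
  have := ep j ji; rewrite /private_of /= -/(closed_loop _ _ _) -/(closed_loop _ _ _).
  by move=> [-> ->]; rewrite es ea eqw.
move=> t' lt R c rho; have [ec es _ ea] := moves _ lt (simP _ lt).
by rewrite /stage_cost ec es ea.
Qed.

(** The strategy s, except that agent i acts at index t as if its private history
    were the one it would have under s and the noise tuple selected from its
    current state and the common information.  The selector is a family over all
    agents and indices, although it is consulted at (i, t) only: this spares any
    transport along j = i and t' = t. *)
Definition pretend i t (sel : forall j t', X j -> common X t' -> noise) s :=
  @Strategy X U
    (fun j t' I => if (j == i) && (t' == t) then
       comm_law s (private_of (closed_loop s (sel j t' (tnth I.1.1 ord_max) I.2) t') j, I.2)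
     else comm_law s I)
    (fun j t' I => if (j == i) && (t' == t) then
       ctrl_law s (private_of (closed_loop s
         (sel j t' (tnth I.1.1 ord_max) (common_past I.2)) t') j, I.2)
     else ctrl_law s I).

Lemma pretend_other i t sel s t' (h : history X U t') :
  t' != t -> same_moves s (pretend i t sel s) h.
Proof.
by move=> /negPf ne; apply: same_movesI => [j|j z _] /=; rewrite ne andbF.
Qed.

Lemma pretend_self i t sel s (h : history X U t) :
    private_of (closed_loop s (sel i t (local_state h i) (hist_C h)) t) i = private_of h i ->
  same_moves s (pretend i t sel s) h.
Proof.
move=> e; apply: same_movesI => [j|j z ez] /=; case: (eqVneq j i) => //= ji;
  by rewrite eqxx; subst j; rewrite ?ez; congr (_ _ (_, _)).
Qed.

Lemma pretend_same i t sel sel' s (h : history X U t) :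
    sel i t (local_state h i) (hist_C h) = sel' i t (local_state h i) (hist_C h) ->
  same_moves (pretend i t sel s) (pretend i t sel' s) h.
Proof.
move=> e; apply: same_movesI => [j|j z ez] /=; case: (eqVneq j i) => //= ji;
  by rewrite eqxx; subst j; rewrite ?ez; congr (_ _ (private_of (closed_loop _ _ _) _, _)).
Qed.

Lemma pretend_reduced i t sel s : reduced_at (pretend i t sel s) i t.
Proof. by split=> a b z /= e; rewrite !eqxx /= e. Qed.

Lemma pretend_reduced_other i t sel s j t' :
  reduced_at s j t' -> (j != i) || (t' != t) -> reduced_at (pretend i t sel s) j t'.
Proof.
move=> [rf rg]; rewrite -negb_and => /negPf ne.
by split=> a b z e /=; rewrite ne; [apply: rf | apply: rg].
Qed.

Lemma pretend_before i t sel s n t' :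
  (t' <= t)%N -> closed_loop (pretend i t sel s) n t' = closed_loop s n t'.
Proof.
move=> le; apply/esym/closed_loop_ext => u lt.
by apply: pretend_other; rewrite ltn_eqF // (leq_trans lt).
Qed.

End FiniteModel.

(** * Averages and minima over finite types *)

Section WeightedSums.
Variable R : realType.

Lemma weighted_mean_attained (A : finType) (E : pred A) (p G : A -> R) (a : R) :
    (forall n, 0 <= p n) -> 0 < \sum_(n | E n) p n ->
    \sum_(n | E n) p n * G n = (\sum_(n | E n) p n) * a ->
  exists2 n, E n & G n <= a.
Proof.
move=> p0 ps eqs; apply: contrapT => no.
have lt n : E n -> a < G n by move=> En; rewrite ltNge; apply/negP => le; apply: no; exists n.
have : \sum_(n | E n) p n * (G n - a) = 0.
  under eq_bigr do rewrite mulrBr.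
  by rewrite sumrB eqs mulr_suml subrr.
move/eqP; rewrite psumr_eq0 => [|n En]; last by rewrite mulr_ge0 // subr_ge0 ltW // lt.
move=> /allP z; move: ps; rewrite big1 ?ltxx // => n En.
have := z n (mem_index_enum n); rewrite En /= mulf_eq0 subr_eq0 => /orP[/eqP //|/eqP e].
by have := lt n En; rewrite e ltxx.
Qed.

(** The strategies do not form a finite type, only their relevant outcomes f s do. *)
Lemma finitely_many_values_min (S : Type) (G : finType) (f : S -> G) (v : G -> R) (s0 : S) :
  exists s, forall s', v (f s) <= v (f s').
Proof.
pose P := [pred g | `[< exists s, f s = g >]].
have P0 : P (f s0) by apply/asboolP; exists s0.
case: (@Order.TotalTheory.arg_minP _ _ _ (f s0) P v P0) => g /asboolP[s <-] min.
by exists s => s'; apply: min; apply/asboolP; exists s'.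
Qed.

End WeightedSums.

(** * Replacing the laws of one agent at one index *)

Section Exchange.
Variables (R : realType) (X U N : 'I_2 -> finType).
Variable k : forall i, nat -> X i -> U i -> N i -> X i.
Variables (T : nat) (c : nat -> joint X -> joint U -> R) (rho : R).
Implicit Types (s : strategy X U) (i j : 'I_2) (t : nat) (n : noise X N T).

Local Notation loop := (closed_loop k).

Variable weight : forall q : slot T, slot_type X N q -> R.
Hypothesis weight_ge0 : forall q v, 0 <= weight (q := q) v.

Definition prob (n : noise X N T) : R := \prod_q weight (n q).

Definition loop_cost s n : R := total_cost s k c rho T (start n) (driver n).

Definition mean_cost s : R := \sum_n prob n * loop_cost s n.

Lemma prob_ge0 n : 0 <= prob n.
Proof. exact: prodr_ge0. Qed.

Definition splice (S : pred (slot T)) n n' : noise X N T :=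
  [ffun q => if S q then n q else n' q].

Lemma splice_swapK S n n' : splice S (splice S n n') (splice S n' n) = n.
Proof. by apply/ffunP => q; rewrite !ffunE; case: (S q). Qed.

Lemma prob_splice S n n' :
  prob (splice S n n') * prob (splice S n' n) = prob n * prob n'.
Proof.
rewrite /prob -!big_split; apply: eq_bigr => q _ /=.
by rewrite !ffunE; case: (S q) => //; rewrite mulrC.
Qed.

(** The pair (splice S n n', splice S n' n) determines (n, n') by the same
    formula and has the same joint weight, so it can replace (n, n') as the
    summation variable; the two sums then separate. *)
Lemma sum_splice S (E : pred (noise X N T)) (F : noise X N T -> R) :
    (forall n n', E n -> E n' -> E (splice S n n')) ->
  \sum_(n | E n) \sum_(n' | E n') prob n * prob n' * F (splice S n n')
  = (\sum_(n | E n) prob n) * \sum_(n | E n) prob n * F n.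
Proof.
move=> closedE.
pose swap (q : noise X N T * noise X N T) := (splice S q.1 q.2, splice S q.2 q.1).
have swapK : involutive swap by case=> n n'; rewrite /swap /= !splice_swapK.
rewrite mulrC mulr_suml; under [RHS]eq_bigr do rewrite mulr_sumr.
rewrite !pair_big /= [RHS](reindex_inj (inv_inj swapK)) /=.
apply: eq_big => [[n n']|[n n'] _] /=; last first.
  by rewrite [RHS]mulrAC prob_splice.
apply/idP/idP => /andP[En En']; first by rewrite !closedE.
have := closedE _ _ En En'; have := closedE _ _ En' En.
by rewrite !splice_swapK => -> ->.
Qed.

(** The coordinates that determine the private history of agent i at index t,
    the common information being given. *)
Definition past i t : pred (slot T) :=
  fun q => (q.1 == i) && (if q.2 is Some u then (u < t)%N else true).

Definition observed s i t n := (local_state (loop s n t) i, hist_C (loop s n t)).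

Lemma splice_past s i t n n' : (t <= T)%N -> observed s i t n = observed s i t n' ->
  [/\ observed s i t (splice (past i t) n n') = observed s i t n,
      private_of (loop s (splice (past i t) n n') t) i = private_of (loop s n t) i &
      forall j, j != i ->
        private_of (loop s (splice (past i t) n n') t) j = private_of (loop s n' t) j].
Proof.
move=> tT [ex eC].
(* Agent i comes from the run of n, the other agents from the run of n'. *)
pose src j := if j == i then n else n'.
have [|j t' lt|j|mC mp] := @closed_loop_rectangle X U N k T s src
    (splice (past i t) n n') t (hist_C (loop s n t)).
- by move=> j; rewrite /start ffunE /past /src /= andbT; case: ifP.
- rewrite /driver ffunE /past /src /= inordK ?lt ?andbT; first by case: ifP.
  by rewrite ltnS (leq_trans (ltnW lt)).
- by rewrite /src; case: ifP.
have mpi : private_of (loop s (splice (past i t) n n') t) i = private_of (loop s n t) i.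
  by rewrite mp /src eqxx.
split=> // [|j /negPf ji]; last by rewrite mp /src ji.
rewrite /observed [hist_C _]mC; congr pair.
by move: mpi; rewrite /private_of /local_state => -[-> _].
Qed.

Definition tail_cost t s n : R := \sum_(t <= t' < T) stage_cost s c rho (loop s n t').

Lemma loop_cost_split t s n : (t <= T)%N ->
  loop_cost s n = \sum_(0 <= t' < t) stage_cost s c rho (loop s n t') + tail_cost t s n.
Proof.
move=> tT; rewrite /loop_cost /total_cost /tail_cost -big_cat_nat //.
by rewrite big_mkord.
Qed.

Lemma tail_cost_ext t s s' n :
    (forall t', (t' < T)%N -> same_moves s s' (loop s n t')) ->
  tail_cost t s n = tail_cost t s' n.
Proof.
move=> same; apply: eq_big_nat => t' /andP[_ lt].
have [ec ea] := same t' lt.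
rewrite /stage_cost ec ea (closed_loop_ext (s' := s')) // => u ltu.
exact/same/(ltn_trans ltu).
Qed.

Definition mimic i t n s := pretend k i t (fun _ _ _ _ => n) s.

Section OneStage.
Variables (s : strategy X U) (i : 'I_2) (t : nat).
Hypothesis tT : (t < T)%N.
Hypothesis red_later : forall t', (t < t' < T)%N -> reduced_at s i t'.

(** Under n', mimicking the private history that agent i has under n gives the
    remaining cost of a tuple in which agent i truly has this private history:
    the splice of the past of agent i from n into n'.  The runs of the two
    tuples differ at index t only in the past of agent i, which a mimicking
    agent ignores. *)
Lemma mimic_tail n n' : observed s i t n = observed s i t n' ->
  tail_cost t (mimic i t n s) n' = tail_cost t s (splice (past i t) n n').
Proof.
move=> eo; have [mo mi mj] := splice_past (ltnW tT) eo.
set m := splice _ n n' in mo mi mj *.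
have before n1 : loop (mimic i t n s) n1 t = loop s n1 t.
  exact: pretend_before.
have -> : tail_cost t s m = tail_cost t (mimic i t n s) m.
  apply: tail_cost_ext => t' _; have [->|ne] := eqVneq t' t.
    exact: pretend_self.
  exact: pretend_other.
have [ex eC] : observed s i t n' = observed s i t m by rewrite mo.
apply: eq_big_nat => t' ltt'; apply: (@closed_loop_forget _ _ _ _ _ _ i t) => //.
- move=> j u /andP[tu uT]; rewrite /driver ffunE /past /=.
  by rewrite inordK ?ltnS ?(ltnW uT) // ltnNge tu andbF.
- move=> u /andP[]; rewrite leq_eqVlt => /orP[/eqP<- _|tu uT].
    exact: pretend_reduced.
  apply: pretend_reduced_other; last by rewrite gtn_eqF ?orbT.
  by apply: red_later; rewrite tu.
- by rewrite !before.
- by rewrite !before.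
- by move=> j ji; rewrite -!/(loop _ _ _) !before mj.
Qed.

(** Averaged over the mimicked tuple n, with weights prob n and over the tuples
    observing o, mimicking costs exactly as much as s: by
    [mimic_tail] this average is a double sum over spliced tuples, and
    [sum_splice] undoes the splicing.  So some n does not exceed the average. *)
Lemma best_representative (n0 : noise X N T) (o : X i * common X t) :
  exists n, \sum_(n' | observed s i t n' == o) prob n' * tail_cost t (mimic i t n s) n'
    <= \sum_(n' | observed s i t n' == o) prob n' * tail_cost t s n'.
Proof.
pose E n := observed s i t n == o.
have [P0|] := eqVneq (\sum_(n | E n) prob n) 0.
  (* On an event of weight zero both sides vanish. *)
  exists n0; have z n : E n -> prob n = 0.
    move/eqP: P0; rewrite psumr_eq0 => [/allP z En|n' _]; last exact: prob_ge0.
    by have := z n (mem_index_enum n); rewrite En => /eqP.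
  by rewrite !big1 // => n' /z ->; rewrite mul0r.
rewrite neq_lt ltNge sumr_ge0 /= => [Ppos|n _]; last exact: prob_ge0.
have [|n _ le] := @weighted_mean_attained R _ E prob
    (fun n => \sum_(n' | E n') prob n' * tail_cost t (mimic i t n s) n')
    (\sum_(n | E n) prob n * tail_cost t s n) prob_ge0 Ppos; last by exists n.
rewrite -(sum_splice (S := past i t)) => [|n n' /eqP en /eqP en'].
  apply: eq_bigr => n /eqP en; rewrite mulr_sumr; apply: eq_bigr => n' /eqP en'.
  by rewrite mulrA mimic_tail // en en'.
rewrite /E; have [|-> _ _] := splice_past (ltnW tT) (n := n) (n' := n') (s := s) (i := i).
  by rewrite en en'.
by rewrite en.
Qed.

(** The last clause lets successive exchanges accumulate. *)
Lemma exchange (n0 : noise X N T) : exists s',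
  [/\ mean_cost s' <= mean_cost s, reduced_at s' i t &
      forall j t', (j != i) || (t' != t) -> reduced_at s j t' -> reduced_at s' j t'].
Proof.
pose sel j t' (x : X j) (z : common X t') : noise X N T :=
  xget n0 [set n |
    \sum_(n' | observed s j t' n' == (x, z)) prob n' * tail_cost t' (mimic j t' n s) n'
    <= \sum_(n' | observed s j t' n' == (x, z)) prob n' * tail_cost t' s n'].
exists (pretend k i t sel s); split.
- rewrite /mean_cost.
  under eq_bigr do rewrite (loop_cost_split _ _ (ltnW tT)) mulrDr.
  under [leRHS]eq_bigr do rewrite (loop_cost_split _ _ (ltnW tT)) mulrDr.
  rewrite !big_split /=; apply: lerD.
    rewrite le_eqVlt; apply/orP; left; apply/eqP; apply: eq_bigr => n _; congr (_ * _).
    apply: eq_big_nat => t' /andP[_ lt].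
    rewrite /stage_cost pretend_before 1?ltnW //.
    have [|<- <- //] := @pretend_other X U N k T i t sel s t' (closed_loop k s n t').
    by rewrite ltn_eqF.
  rewrite [leLHS](partition_big (observed s i t) xpredT) //.
  rewrite [leRHS](partition_big (observed s i t) xpredT) //.
  (* On the event (x, z), the selected tuple is the constant sel i t x z. *)
  apply: ler_sum => -[x z] _ /=.
  have /(xgetPex n0) best := best_representative n0 (x, z).
  apply: le_trans best; rewrite -/(sel i t x z) le_eqVlt; apply/orP; left; apply/eqP.
  apply: eq_bigr => n /eqP[ex ez]; congr (_ * _).
  apply: tail_cost_ext => t' lt; have [->|ne] := eqVneq t' t.
    rewrite pretend_before //; apply: pretend_same.
    by rewrite ex ez.
  set h := loop _ n t'.
  have [e1 e2] := @pretend_other X U N k T i t sel s t' h ne.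
  have [e3 e4] := @pretend_other X U N k T i t (fun _ _ _ _ => sel i t x z) s t' h ne.
  by split; rewrite -?e1 -?e2.
- exact: pretend_reduced.
- by move=> j t' ne red; apply: pretend_reduced_other.
Qed.

End OneStage.

(** * Backward induction and existence of a best strategy *)

(** Backward induction on the index: at each index agent 1 is treated first, then
    agent 2, and [exchange] preserves what has been achieved before. *)
Lemma reduce_all (n0 : noise X N T) s : exists2 s', mean_cost s' <= mean_cost s &
  forall j t, (t < T)%N -> reduced_at s' j t.
Proof.
suff: forall u, (u <= T)%N -> exists2 s', mean_cost s' <= mean_cost s &
    forall j t, (T - u <= t < T)%N -> reduced_at s' j t.
  move=> /(_ T (leqnn T))[s' le red]; exists s' => // j t lt.
  by apply: red; rewrite subnn.
elim=> [_|u IH uT].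
  by exists s => // j t; rewrite subn0 => /andP[/leq_ltn_trans h /h]; rewrite ltnn.
have [s1 le1 red1] := IH (ltnW uT).
have tT : (T - u.+1 < T)%N by rewrite ltn_subrL (leq_ltn_trans _ uT).
have later t' : (T - u.+1 < t' < T)%N -> (T - u <= t' < T)%N.
  by rewrite -subSn // subSS.
have [t' lt'|s2 [le2 red2 keep2]] := exchange (s := s1) (i := ord0) tT _ n0.
  exact/red1/later.
have [t' lt'|s3 [le3 red3 keep3]] := exchange (s := s2) (i := ord_max) tT _ n0.
  by apply: keep2 => //; exact/red1/later.
exists s3 => [|j t' /andP[]]; first exact: le_trans le3 (le_trans le2 le1).
rewrite leq_eqVlt => /orP[/eqP <- _|lt ltT].
  have [-> //|jm] := eqVneq j ord_max.
  apply: keep3; rewrite ?jm //.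
  suff -> : j = ord0 by [].
  by apply: val_inj; case: j jm => [[|[|//]] ?].
apply: keep3; first by rewrite gtn_eqF ?orbT.
apply: keep2; first by rewrite gtn_eqF ?orbT.
by apply/red1/later; rewrite lt.
Qed.

(** A law that ignores the past may be fed a fictitious past, here the constant
    one; this turns it into a function of the current state. *)
Lemma reduced_form s : (forall i, (0 < #|U i|)%N) ->
    (forall j t, (t < T)%N -> reduced_at s j t) ->
  exists r : reduced_strategy X U, mean_cost (strategy_of_reduced r) = mean_cost s.
Proof.
move=> U0 red.
have u0 i : U i by case/card_gt0P/sigW: (U0 i).
pose pad i t (x : X i) : private_info X U i t := (nseq_tuple t.+1 x, nseq_tuple t (u0 i)).
exists (ReducedStrategy (fun i t x z => comm_law s (pad i t x, z))
                        (fun i t x z => ctrl_law s (pad i t x, z))).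
apply: eq_bigr => n _; rewrite !(loop_cost_split _ _ (leq0n T)) !big_geq // !add0r.
congr (_ * _); apply: tail_cost_ext => t lt.
by apply: same_movesI => [j|j z _] /=; apply: (red j t lt).1 || apply: (red j t lt).2;
  rewrite /= tnth_nseq.
Qed.

(** The cost depends on the strategy only through the states, actions and
    communications along the run of each noise tuple, and these are the values of
    a function between finite types. *)
Lemma mean_cost_min (s0 : strategy X U) :
  exists s, forall s', mean_cost s <= mean_cost s'.
Proof.
pose traj s : {ffun noise X N T * 'I_T -> joint X * joint U * bool} :=
  [ffun q : noise X N T * 'I_T => (cur_state (loop s q.1 q.2), cur_action s (loop s q.1 q.2),
              Mor (cur_comm s (loop s q.1 q.2)))].
pose value (g : {ffun noise X N T * 'I_T -> joint X * joint U * bool}) : R :=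
  \sum_n prob n * \sum_(t < T) (c t (g (n, t)).1.1 (g (n, t)).1.2 + rho * (g (n, t)).2%:R).
have mean_costE s : mean_cost s = value (traj s).
  by apply: eq_bigr => n _; congr (_ * _); apply: eq_bigr => t _; rewrite ffunE.
have [s min] := finitely_many_values_min traj value s0.
by exists s => s'; rewrite !mean_costE.
Qed.

Lemma reduced_optimal (n0 : noise X N T) : (forall i, (0 < #|U i|)%N) ->
  exists r : reduced_strategy X U, forall s,
    mean_cost (strategy_of_reduced r) <= mean_cost s.
Proof.
move=> U0; have u0 i : U i by case/card_gt0P/sigW: (U0 i).
have [s min] := mean_cost_min (Strategy (fun _ _ _ => false) (fun i _ _ => u0 i)).
have [s' le red] := reduce_all n0 s.
have [r er] := reduced_form U0 red.
by exists r => s1; rewrite er (le_trans le).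
Qed.

End Exchange.

(** * From random variables to finite noise tuples *)

Lemma expectation_finite_valued (R : realType) d (Omega : measurableType d)
    (P : probability Omega R) (G : finType) (nu : Omega -> G) (f : G -> R) :
    (forall g, measurable (nu @^-1` [set g])) ->
  ('E_P[fun omega => f (nu omega)] = \sum_g (f g)%:E * P (nu @^-1` [set g]))%E.
Proof.
move=> mnu; rewrite unlock.
have cover : [set: Omega] = \big[setU/set0]_(g <- enum G) (nu @^-1` [set g]).
  rewrite -bigcup_seq; apply/seteqP; split=> // omega _.
  by exists (nu omega) => //=; rewrite mem_enum.
rewrite cover integral_bigsetU_EFin ?enum_uniq //; first last.
- rewrite -cover => _ Y _; rewrite setTI.
  have -> : (EFin \o (fun omega => f (nu omega))) @^-1` Y
          = \bigcup_(g in [set g | Y (f g)%:E]) (nu @^-1` [set g]).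
    apply/seteqP; split=> [omega /= Yo|omega [g /= Yg ->] //].
    by exists (nu omega).
  exact: fin_bigcup_measurable.
- by move=> g g' _ _ [omega [/= <- <-]].
rewrite big_enum; apply: eq_bigr => g _.
rewrite (eq_integral (cst (f g)%:E)) ?integral_cst // => omega.
by rewrite inE /= => ->.
Qed.

Section Primitives.
Variables (R : realType) (X U : 'I_2 -> finType) (dW : 'I_2 -> measure_display).
Variables (W : forall i, measurableType (dW i)).
Variable k : forall i, nat -> X i -> U i -> W i -> X i.
Hypothesis k_meas : forall i t x u y, measurable (@k i t x u @^-1` [set y]).
Variables (T : nat) (d : measure_display) (Omega : measurableType d).
Variables (P : probability Omega R) (x1 : forall i, Omega -> X i).
Variable w : forall i, nat -> {mfun Omega >-> W i}.
Hypothesis x1_meas : forall i x, measurable (x1 i @^-1` [set x]).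
Hypothesis indep : mutually_independent P (primitive_events x1 w).

(** All that the dynamics of agent i can extract from one noise value: the map
    from (state, action) to the next state.  Unlike the noise, it is finite. *)
Definition response i : finType := {ffun X i * U i -> X i}.

Definition respond i (t : nat) (x : X i) (u : U i) (v : response i) : X i := v (x, u).

Definition responses (omega : Omega) : noise X response T :=
  [ffun q => match q return slot_type X response q with
    | (i, None) => x1 i omega
    | (i, Some t) => [ffun xu => k t xu.1 xu.2 (w i t omega)]
    end].

Lemma responsesE omega i t x u : (t <= T)%N ->
  driver (responses omega) i t (x, u) = k t x u (w i t omega).
Proof. by move=> tT; rewrite /driver ffunE /= ffunE /= inordK. Qed.

Lemma run_responses s omega t : (t <= T)%N ->
  run s k (x1^~ omega) (fun i t' => w i t' omega) t
  = closed_loop respond s (responses omega) t.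
Proof.
elim: t => [_|t IH tT]; rewrite /closed_loop /=.
  by congr History; apply: functional_extensionality_dep => i; rewrite /start ffunE.
rewrite IH ?(ltnW tT) // -/(closed_loop _ _ _ _) /next_history; congr History.
apply: functional_extensionality_dep => i; congr rcons_tuple.
by rewrite /respond responsesE ?(ltnW tT).
Qed.

Definition slot_event (q : slot T) (v : slot_type X response q) : set Omega :=
  [set omega | responses omega q = v].

Definition slot_index (q : slot T) : 'I_2 * option nat :=
  (q.1, omap (@nat_of_ord _) q.2).

(** An event about a response is an event about the noise behind it, because it
    is a finite intersection of events on single values of k. *)
Lemma primitive_slot_event q v :
  primitive_events x1 w (slot_index q) (@slot_event q v).
Proof.
case: q v => i [t|] v; rewrite /primitive_events /=; last first.
  by exists [set v] => //; rewrite setTI; apply/seteqP; split => omega;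
    rewrite /slot_event /= ffunE.
exists (\bigcap_(xu in [set: X i * U i]) 
    ((fun y => k t xu.1 xu.2 y) @^-1` [set (v : response i) xu])).
  exact: fin_bigcap_measurable.
rewrite setTI; apply/seteqP; split => omega; rewrite /slot_event /= ffunE.
  by move=> e; apply/ffunP => xu; rewrite ffunE; apply: e.
by move=> <- xu _ /=; rewrite ffunE.
Qed.

Lemma slot_event_measurable q v : measurable (@slot_event q v).
Proof.
have := primitive_slot_event v; case: q v => i [t|] v; rewrite /primitive_events /=.
  by case=> B mB <-; exact: measurable_funPT.
case=> B _ <-; rewrite setTI.
have -> : x1 i @^-1` B = \bigcup_(x in B) (x1 i @^-1` [set x]).
  by apply/seteqP; split=> [omega Bo|omega [x Bx /= ->] //]; exists (x1 i omega).
exact: fin_bigcup_measurable.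
Qed.

Lemma responses_event (n : noise X response T) :
  responses @^-1` [set n] = \bigcap_(q in [set: slot T]) slot_event (n q).
Proof.
apply/seteqP; split=> [omega /= <- q _ //|omega e].
by apply/ffunP => q; exact: e.
Qed.

Lemma responses_measurable n : measurable (responses @^-1` [set n]).
Proof.
rewrite responses_event; apply: fin_bigcap_measurable => [|q _]; first exact: finite_finset.
exact: slot_event_measurable.
Qed.

Definition response_weight q (v : slot_type X response q) : R :=
  fine (P (slot_event v)).

(** Independence is used here only, for the finite family of all slots. *)
Lemma responses_law n :
  P (responses @^-1` [set n]) = (prob response_weight n)%:E.
Proof.
pose J : {fset 'I_2 * option nat} := seq_fset tt [seq slot_index q | q <- enum {: slot T}].
pose back (j : 'I_2 * option nat) : slot T := (j.1, omap inord j.2).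
have indexK : cancel slot_index back.
  by case=> i [t|] //; rewrite /back /slot_index /= inord_val.
have inJ j : reflect (exists q, j = slot_index q) (j \in J).
  rewrite seq_fsetE; apply: (iffP mapP) => [[q _ ->]|[q ->]]; exists q => //.
  by rewrite mem_enum.
rewrite responses_event.
have -> : \bigcap_(q in [set: slot T]) slot_event (n q)
        = \bigcap_(j in [set` J]) slot_event (n (back j)).
  apply/seteqP; split=> [omega e j _|omega e q _]; first exact: e.
  by rewrite -(indexK q); apply: e; apply/inJ; exists q.
rewrite indep => [|j /inJ[q ->]]; last by rewrite indexK; exact: primitive_slot_event.
rewrite (perm_big _ (seq_fset_perm _ _)) /= undup_id; last first.
  by rewrite map_inj_uniq ?enum_uniq //; exact: can_inj indexK.
rewrite big_map big_enum /prob -prodEFin; apply: eq_bigr => q _.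
by rewrite indexK fineK // fin_num_measure //; exact: slot_event_measurable.
Qed.

Lemma expected_cost_mean_cost (c : nat -> joint X -> joint U -> R) rho s :
  expected_cost k c rho T P x1 w s = (mean_cost respond c rho response_weight s)%:E.
Proof.
rewrite /expected_cost.
have -> : (fun omega => total_cost s k c rho T (x1^~ omega) (fun i t => w i t omega))
        = (fun omega => loop_cost respond c rho s (responses omega)).
  apply: funext => omega; apply: eq_bigr => t _.
  by rewrite run_responses ?(ltnW (ltn_ord t)).
rewrite expectation_finite_valued; last exact: responses_measurable.
rewrite /mean_cost -sumEFin; apply: eq_bigr => n _.
by rewrite responses_law -EFinM mulrC.
Qed.

End Primitives.

Theorem proposition1 (R : realType)
    (X U : 'I_2 -> finType) (U_nonempty : forall i, (0 < #|U i|)%N)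
    (dW : 'I_2 -> measure_display) (W : forall i, measurableType (dW i))
    (k : forall i, nat -> X i -> U i -> W i -> X i)
    (k_meas : forall i t x u y, measurable (@k i t x u @^-1` [set y]))
    (T : nat) (c : nat -> joint X -> joint U -> R) (rho : R)
    (PX1 : forall i, X i -> R) (PW : forall i, probability (W i) R)
    (d : measure_display) (Omega : measurableType d) (P : probability Omega R)
    (x1 : forall i, Omega -> X i)
    (w : forall i, nat -> {mfun Omega >-> W i})
    (x1_meas : forall i x, measurable (x1 i @^-1` [set x]))
    (x1_law : forall i x, P (x1 i @^-1` [set x]) = (PX1 i x)%:E)
    (w_law : forall i t (A : set (W i)), measurable A ->
       distribution P (w i t) A = PW i A)
    (indep : mutually_independent P (primitive_events x1 w)) :
  exists s : reduced_strategy X U, forall s' : strategy X U,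
    (expected_cost k c rho T P x1 w (strategy_of_reduced s)
      <= expected_cost k c rho T P x1 w s')%E.
Proof.
(* A probability space has a point, which makes the finite model nonempty. *)
have /set0P[omega _] : [set: Omega] != set0.
  apply/eqP => O0; have := probability_setT P.
  by rewrite O0 measure0 => /esym/eqP; rewrite onee_eq0.
have weight_ge0 q v : 0 <= response_weight k P x1 w (T := T) (q := q) v.
  exact: fine_ge0.
have [r min] := reduced_optimal (@respond X U) c rho weight_ge0
  (responses k T x1 w omega) U_nonempty.
by exists r => s; rewrite !expected_cost_mean_cost // lee_fin.
Qed.
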